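(* Let $\ell,m,n\in\mathbb{N}$, let $g\in \operatorname{SL}(m+n,\mathcal{K}_{\ell})$ be a diagonal matrix, let $\boldsymbol{\alpha}$ be an $m\times n$ matrix with entries in $\mathcal{K}$, and let $$u=\begin{pmatrix} \mathrm{I}_m&\boldsymbol{\alpha}\\ 0&\mathrm{I}_n \end{pmatrix}\in\operatorname{SL}(m+n,\mathcal{K}).$$ Then $\lambda_1(gu\widetilde{\mathcal{R}}^{m+n})=\lambda_1(gu\mathcal{R}^{m+n})$.
   Context: Let $q$ be a power of a prime, $\mathcal{R}=\mathbb{F}_q[T]$, $\mathcal{K}=\mathbb{F}_q((T^{-1}))$ with absolute value $|a|=q^{\deg a}$. $\mathcal{K}_\ell=\mathcal{K}(T^{1/\ell})$ is the extension obtained by adjoining an $\ell$-th root of $T$, with the extended absolute value ($|T^{1/\ell}|=q^{1/\ell}$), and $\widetilde{\mathcal{R}}=\mathbb{F}_q[T^{1/\ell}]\subseteq\mathcal{K}_\ell$. $\mathcal{K}_\ell^{m+n}$ carries the sup norm. For a discrete subgroup $\Gamma$ of $\mathcal{K}_\ell^{m+n}$, the first minimum $\lambda_1(\Gamma)$ is the infimum of $\lambda>0$ such that the ball of radius $\lambda$ centered at the origin contains a nonzero vector of $\Gamma$. *)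

(* Defs.v *)
From HB Require Import structures.
From mathcomp Require Import all_boot all_order all_algebra all_field.
From mathcomp Require Import zify ring.
From mathcomp Require Import boolp classical_sets fsbigop reals.

Set Implicit Arguments.
Unset Strict Implicit.
Unset Printing Implicit Defensive.

Import Order.TTheory GRing.Theory Num.Theory.
Local Open Scope ring_scope.

(** [laurent F] is the field F((T^-1)): a series is given by its coefficients,
    [a n] being the coefficient of T^n, and only finitely many coefficients of
    positive exponent are nonzero. *)
Record laurent (F : fieldType) := Laurent {
  lcoef :> int -> F;
  lcoef_bounded : exists N : int, forall n : int, N < n -> lcoef n = 0
}.

Section LaurentField.
Variable F : fieldType.
Implicit Types (a b c : laurent F) (M N n d : int).

Lemma laurentP a b : (forall n, a n = b n) <-> a = b.
Proof.
split=> [ab|->//]; case: a b ab => [a pa] [b pb] /= ab.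
have {}ab : a = b by apply: funext.
by rewrite ab in pa *; congr Laurent; apply: Prop_irrelevance.
Qed.

HB.instance Definition _ := gen_eqMixin (laurent F).
HB.instance Definition _ := gen_choiceMixin (laurent F).

Fact lmono_bounded (x : F) d :
  exists N, forall n, N < n -> (if n == d then x else 0) = 0.
Proof. by exists d => n /gt_eqF ->. Qed.

(* the monomial x T^d *)
Definition lmono (x : F) d := Laurent (lmono_bounded x d).

Definition lzero := lmono 0 0.
Definition lone := lmono 1 0.

Fact lopp_bounded a : exists N, forall n, N < n -> - a n = 0.
Proof. by have [N aN] := lcoef_bounded a; exists N => n /aN ->; rewrite oppr0. Qed.
Definition lopp a := Laurent (lopp_bounded a).

Fact ladd_bounded a b : exists N, forall n, N < n -> a n + b n = 0.
Proof.
have [[M aM] [N bN]] := (lcoef_bounded a, lcoef_bounded b).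
exists (Num.max M N) => n; rewrite gt_max => /andP[/aM -> /bN ->].
exact: addr0.
Qed.
Definition ladd a b := Laurent (ladd_bounded a b).

Lemma lzeroE n : lzero n = 0.
Proof. by rewrite /= if_same. Qed.

Fact laddA : associative ladd.
Proof. by move=> a b c; apply/laurentP => n; apply: addrA. Qed.
Fact laddC : commutative ladd.
Proof. by move=> a b; apply/laurentP => n; apply: addrC. Qed.
Fact ladd0 : left_id lzero ladd.
Proof. by move=> a; apply/laurentP => n; rewrite /= if_same add0r. Qed.
Fact laddN : left_inverse lzero lopp ladd.
Proof. by move=> a; apply/laurentP => n; rewrite /= if_same addNr. Qed.

HB.instance Definition _ :=
  GRing.isZmodule.Build (laurent F) laddA laddC ladd0 laddN.

(* The sum below ranges over Z and has finite support. *)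
Definition lmul_coef a b n : F := \sum_(i \in [set: int]) a i * b (n - i).

Lemma lmul_coefE a b M N :
    (forall n, M < n -> a n = 0) -> (forall n, N < n -> b n = 0) ->
  forall j : nat, lmul_coef a b (M + N - j%:Z) =
    \sum_(k < j.+1) a (M - k%:Z) * b (N - (j - k)%N%:Z).
Proof.
move=> aM bN j.
rewrite /lmul_coef (fsbigE [seq M - k%:Z | k <- iota 0 j.+1]) //; last first.
- move=> i _ /mapP iP; have [Mi|iM] := ltP M i; first by rewrite aM // mul0r.
  rewrite bN ?mulr0 //; rewrite ltNge; apply/negP => le_i; apply: iP.
  by exists (absz (M - i)%R); [rewrite mem_iota|]; lia.
- by rewrite map_inj_uniq ?iota_uniq // => x y xy; lia.
rewrite (eq_bigl xpredT) => [|i]; last by rewrite in_setT.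
rewrite big_map -[iota 0 j.+1]/(index_iota 0 j.+1) big_mkord.
apply: eq_bigr => k _; congr (_ * b _); have := ltn_ord k; lia.
Qed.

Lemma lmul_coef_bounded a b M N :
    (forall n, M < n -> a n = 0) -> (forall n, N < n -> b n = 0) ->
  forall n, M + N < n -> lmul_coef a b n = 0.
Proof.
move=> aM bN n ltn; apply: fsbig1 => i _.
have [Mi|iM] := ltP M i; first by rewrite aM // mul0r.
by rewrite bN ?mulr0 //; lia.
Qed.

Fact lmul_bounded a b : exists N, forall n, N < n -> lmul_coef a b n = 0.
Proof.
have [[M aM] [N bN]] := (lcoef_bounded a, lcoef_bounded b).
by exists (M + N); apply: lmul_coef_bounded.
Qed.
Definition lmul a b := Laurent (lmul_bounded a b).

Let trunc a M J := \poly_(k < J.+1) a (M - k%:Z).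

Lemma lmul_trunc a b M N J :
    (forall n, M < n -> a n = 0) -> (forall n, N < n -> b n = 0) ->
  forall j : nat, (j <= J)%N ->
    lmul a b (M + N - j%:Z) = (trunc a M J * trunc b N J)`_j.
Proof.
move=> aM bN j jJ; rewrite /= (lmul_coefE aM bN) coefM.
apply: eq_bigr => k _; have := ltn_ord k.
by rewrite !coef_poly => kj; rewrite !ifT //; lia.
Qed.

Lemma lbound_ge a P : exists2 M : int, P <= M & forall n, M < n -> a n = 0.
Proof.
have [N aN] := lcoef_bounded a; exists (Num.max P N); first by rewrite le_max lexx.
by move=> n; rewrite gt_max => /andP[_ /aN].
Qed.

Fact lmulC : commutative lmul.
Proof.
move=> a b; apply/laurentP => n.
have [N _ bN] := lbound_ge b 0; have [M nM aM] := lbound_ge a (n - N).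
have -> : n = M + N - (absz (M + N - n)%R)%:Z by lia.
by rewrite (lmul_trunc aM bN (leqnn _)) mulrC -(lmul_trunc bN aM) // (addrC N).
Qed.

Fact lmulA : associative lmul.
Proof.
move=> a b c; apply/laurentP => n.
have [N _ bN] := lbound_ge b 0; have [P _ cP] := lbound_ge c 0.
have [M nM aM] := lbound_ge a (n - N - P).
have abM := lmul_coef_bounded aM bN; have bcN := lmul_coef_bounded bN cP.
have -> : n = M + (N + P) - (absz (M + N + P - n)%R)%:Z by lia.
set j := absz _.
rewrite [LHS](@lmul_coefE a (lmul b c) _ _ aM bcN) {1}addrA.
rewrite [RHS](@lmul_coefE (lmul a b) c _ _ abM cP).
transitivity (trunc a M j * trunc b N j * trunc c P j)`_j.
  rewrite -mulrA coefM; apply: eq_bigr => k _; have := ltn_ord k => kj.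
  by rewrite -(lmul_trunc bN cP) ?leq_subr // coef_poly kj.
rewrite coefM; apply: eq_bigr => k _; have := ltn_ord k => kj.
by rewrite -(lmul_trunc aM bN) // coef_poly ifT //; lia.
Qed.

Lemma lmul_monol (x : F) d a n : lmul (lmono x d) a n = x * a (n - d).
Proof.
rewrite /= /lmul_coef (fsbigE [:: d]) //=; last first.
  by move=> i _; rewrite inE => /negPf ->; rewrite mul0r.
rewrite (eq_bigl xpredT) => [|i]; last by rewrite in_setT.
by rewrite big_seq1 eqxx.
Qed.

Fact lmul1 : left_id lone lmul.
Proof. by move=> a; apply/laurentP => n; rewrite lmul_monol mul1r subr0. Qed.

Fact lmulDl : left_distributive lmul +%R.
Proof.
move=> a b c; apply/laurentP => n.
have [N _ bN] := lbound_ge b 0; have [P _ cP] := lbound_ge c 0.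
have [M nM aM] := lbound_ge a (Num.max N (n - P)).
have {}bN k : M < k -> b k = 0.
  by move=> Mk; apply: bN; apply: le_lt_trans Mk; lia.
have abM k : M < k -> (a + b) k = 0.
  by move=> Mk; rewrite /= aM // bN // addr0.
have -> : n = M + P - (absz (M + P - n)%R)%:Z by lia.
rewrite [LHS](@lmul_coefE (a + b) c _ _ abM cP).
rewrite [RHS]/= (lmul_coefE aM cP) (lmul_coefE bN cP) -big_split /=.
by apply: eq_bigr => k _; rewrite mulrDl.
Qed.

Fact lone_neq0 : lone != 0.
Proof.
apply/eqP => /laurentP/(_ 0); rewrite lzeroE /= => /eqP.
by rewrite oner_eq0.
Qed.

HB.instance Definition _ := GRing.Zmodule_isComNzRing.Build (laurent F)
  lmulA lmulC lmul1 lmulDl lone_neq0.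

Definition is_ldeg a : set int :=
  [set d | a d != 0 /\ forall n, d < n -> a n = 0].

Lemma is_ldeg_exists a : a != 0 -> exists d, is_ldeg a d.
Proof.
move=> a0; have [N aN] := lcoef_bounded a.
have /ex_minnP[k ak kmin] : exists k : nat, a (N - k%:Z) != 0.
  apply: contrapT => /forallNP aE; case/eqP: a0; apply/laurentP => n.
  rewrite lzeroE; have [/aN //|nN] := ltP N n.
  have := aE (absz (N - n)%R) => /negP/negPn/eqP <-; congr (a _); lia.
exists (N - k%:Z); split=> // n kn; have [/aN //|nN] := ltP N n.
have : ~~ (a (N - (absz (N - n)%R)%:Z) != 0).
  by apply/negP => /kmin; lia.
by move=> /negPn/eqP <-; congr (a _); lia.
Qed.

(* coefficients of the inverse of a series with leading exponent d *)
Let inv_prefix a d := fix pre (j : nat) : seq F :=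
  if j is i.+1 then
    rcons (pre i) (((i == 0%N)%:R
      - \sum_(k < i) a (d - k.+1%:Z) * (pre i)`_(i - k.+1)) / a d)
  else [::].

Lemma lmul_inv_exists a : a != 0 -> exists b, b * a = 1.
Proof.
move=> /is_ldeg_exists[d [ad0 ad]].
pose c i := (inv_prefix a d i.+1)`_i.
have szp j : size (inv_prefix a d j) = j by elim: j => //= j; rewrite size_rcons => ->.
have prefE i j : (i < j)%N -> (inv_prefix a d j)`_i = c i.
  elim: j => // j IHj; rewrite ltnS leq_eqVlt => /predU1P[-> //|ij].
  by rewrite /= nth_rcons szp ij IHj.
have cE i : a d * c i + \sum_(k < i) a (d - k.+1%:Z) * c (i - k.+1)%N = (i == 0%N)%:R.
  rewrite {1}/c /= nth_rcons szp ltnn eqxx mulrC divfK //.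
  rewrite (eq_bigr (fun k : 'I_i => a (d - k.+1%:Z) * c (i - k.+1)%N)) ?subrK //.
  by move=> k _; rewrite prefE //; have := ltn_ord k; lia.
pose bc n := if n <= - d then c (absz (- d - n)%R) else 0.
have bP n : - d < n -> bc n = 0 by rewrite /bc; case: leP.
exists (Laurent (ex_intro _ (- d) bP)); rewrite mulrC; apply/laurentP => n.
have [n0|n0] := ltP 0 n.
  rewrite [LHS](@lmul_coef_bounded a (Laurent _) d (- d) ad bP) ?subrr //=.
  by rewrite gt_eqF.
have {1}-> : n = d + (- d) - (absz n)%:Z by lia.
rewrite [LHS](@lmul_coefE a (Laurent _) d (- d) ad bP) big_ord_recl subr0 subn0.
have -> : (1 : laurent F) n = (absz n == 0%N)%:R by rewrite /= absz_eq0; case: eqP.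
rewrite -cE; congr (_ * _ + _).
  by rewrite /= /bc ifT; [congr c|]; lia.
apply: eq_bigr => k _; congr (_ * _); rewrite /= /bc /bump /= ifT; last by lia.
by congr c; have := ltn_ord k; lia.
Qed.

Definition linv a : laurent F := xget 0 [set b | b * a = 1].

Fact lmulVf a : a != 0 -> linv a * a = 1.
Proof. by move=> /lmul_inv_exists; apply: (@xgetPex _ 0 [set b | b * a = 1]). Qed.

Fact linv0 : linv 0 = 0.
Proof.
rewrite /linv; case: xgetP => // b _ /= /eqP.
by rewrite mulr0 eq_sym oner_eq0.
Qed.

HB.instance Definition _ := GRing.ComNzRing_isField.Build (laurent F) lmulVf linv0.

Definition laurC (x : F) : laurent F := lmono x 0.

Definition laurT : laurent F := lmono 1 1.

Fact laurC_is_zmod_morphism : zmod_morphism laurC.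
Proof.
by move=> x y; apply/laurentP => n /=; case: ifP => // _; rewrite subrr.
Qed.

Fact laurC_is_monoid_morphism : monoid_morphism laurC.
Proof.
split=> // x y; apply/laurentP => n.
by rewrite [RHS]lmul_monol subr0 /=; case: ifP => // _; rewrite mulr0.
Qed.

HB.instance Definition _ :=
  GRing.isZmodMorphism.Build F (laurent F) laurC laurC_is_zmod_morphism.
HB.instance Definition _ :=
  GRing.isMonoidMorphism.Build F (laurent F) laurC laurC_is_monoid_morphism.

(* junk value at 0, where [is_ldeg] is empty *)
Definition ldeg a : int := xget 0 (is_ldeg a).

End LaurentField.

Arguments laurT {F}.

Definition labs (F : finFieldType) (R : realType) (a : laurent F) : R :=
  if a == 0 then 0 else #|F|%:R ^ ldeg a.

Record absolute_value (R : realType) (L : fieldType) (v : L -> R) : Prop := {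
  absv_ge0 : forall x, 0 <= v x;
  absv_eq0 : forall x, v x = 0 <-> x = 0;
  absvM : forall x y, v (x * y) = v x * v y;
  absvD : forall x y, v (x + y) <= v x + v y
}.

(** [L], with its element [theta] and the function [v], is the extension
    K(T^(1/l)) of K = F((T^-1)) with the extended absolute value.  The value
    of [v] at [theta] is forced to be q^(1/l) by multiplicativity. *)
Record root_extension (F : finFieldType) (R : realType) (l : nat)
    (L : fieldExtType (laurent F)) (theta : L) (v : L -> R) : Prop := {
  root_ext_pow : theta ^+ l = laurT%:A;
  root_ext_gen : <<1; theta>>%VS = {:L}%VS;
  root_ext_absv : absolute_value v;
  root_ext_extends : forall a : laurent F, v a%:A = labs R a
}.

Section Lattices.
Variables (F : finFieldType) (R : realType) (L : fieldExtType (laurent F)).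

(* F[x] as a subset of L: the values at x of the polynomials over F *)
Definition poly_values (x : L) : set L :=
  [set (map_poly (in_alg L \o @laurC F) p).[x] | p in [set: {poly F}]].

Definition lattice k (h : 'M[L]_k) (S : set L) : set 'cV[L]_k :=
  [set h *m w | w in [set w : 'cV[L]_k | forall i, S (w i ord0)]].

Definition supnorm (v : L -> R) k (w : 'cV[L]_k) : R :=
  \big[Num.max/0]_(i < k) v (w i ord0).

Definition lambda1 (v : L -> R) k (G : set 'cV[L]_k) : R :=
  inf [set r : R | 0 < r /\ exists w, [/\ G w, w != 0 & supnorm v w <= r]].

End Lattices.

Definition unip (K : fieldType) m n (alpha : 'M[K]_(m, n)) : 'M[K]_(m + n) :=
  block_mx 1%:M alpha 0 1%:M.

(* Main.v *)
Require Import Defs.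
From mathcomp Require Import all_boot all_order all_algebra all_field.
From mathcomp Require Import boolp classical_sets reals.

Set Implicit Arguments.
Unset Strict Implicit.
Unset Printing Implicit Defensive.

Import Order.TTheory GRing.Theory Num.Theory.
Local Open Scope ring_scope.

(** Write [q] for the order of [F] and [t] for the absolute value of [theta], so
    that [t ^ l = q].  Grouping the exponents of a polynomial in [theta] by their
    residues modulo [l] writes a vector [w] with entries in [F[theta]] as
    [w = \sum_(i < l) theta ^ i w_i], where each [w_i] has entries in [F[T]]
    ([horner_mod_part]).  As [u] has entries in K and [g] is diagonal, the [j]-th
    coordinate of [g u w] is [g_j \sum_i theta ^ i (u w_i)_j], with all the
    [(u w_i)_j] in K.  Nonzero terms of this last sum have absolute values
    [t ^ (l d + i)], with [d] the degree of [(u w_i)_j]; these are pairwise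
    distinct since the exponents differ modulo [l].  The absolute value being
    ultrametric, that of the sum is the largest of those of its terms, and since
    [t > 1] it bounds each [|(u w_i)_j|] from above ([absv_coef_le]).  Hence no
    [g u w_i] is longer than [g u w], and if [w] is nonzero then so is some
    [w_i], whose image under the invertible [g u] is a nonzero vector of the
    smaller lattice.  As [F[T]] is contained in [F[theta]], both lattices
    have nonzero vectors in exactly the same balls around the origin. *)

(** * Absolute values in positive characteristic *)

Section AbsoluteValue.
Variables (R : realType) (L : fieldType) (v : L -> R).
Hypothesis v_abs : absolute_value v.

Lemma absv0 : v 0 = 0.
Proof. exact/(absv_eq0 v_abs). Qed.

Lemma absv1 : v 1 = 1.
Proof.
have v1 : v 1 != 0 by apply/eqP => /(absv_eq0 v_abs)/eqP; rewrite oner_eq0.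
by apply: (mulfI v1); rewrite -(absvM v_abs) !mulr1.
Qed.

Lemma absvX x k : v (x ^+ k) = v x ^+ k.
Proof.
elim: k => [|k IHk]; first by rewrite !expr0 absv1.
by rewrite !exprS (absvM v_abs) IHk.
Qed.

Lemma absvN x : v (- x) = v x.
Proof.
apply/eqP; rewrite -(@eqrXn2 _ 2) ?(absv_ge0 v_abs) //.
by rewrite -!absvX sqrrN.
Qed.

(** In characteristic [p] the powers [p ^ k] are additive, so the triangle
    inequality gives [v (x + y) ^ p ^ k <= 2 c ^ p ^ k] for all [k], and the
    factor 2 vanishes in the limit. *)
Lemma absv_ultra p (pL : p \in [pchar L]) x y c :
  v x <= c -> v y <= c -> v (x + y) <= c.
Proof.
move=> xc yc; have p_gt1 := prime_gt1 (pcharf_prime pL).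
have c0 : 0 <= c := le_trans (absv_ge0 v_abs x) xc.
have powb k : v (x + y) ^+ (p ^ k) <= 2 * c ^+ (p ^ k).
  rewrite -absvX exprDn_pchar; last first.
    by rewrite (eq_pnat _ (pcharf_eq pL)) pnatX pnat_id ?(pcharf_prime pL).
  apply: le_trans (absvD v_abs _ _) _; rewrite !absvX mulr_natl mulr2n.
  by apply: lerD; apply: lerXn2r; rewrite ?nnegrE ?(absv_ge0 v_abs).
rewrite leNgt; apply/negP => ltc.
have [c_eq0|c_neq0] := eqVneq c 0.
  have := powb 0; rewrite expn0 !expr1 c_eq0 mulr0 leNgt.
  by rewrite -c_eq0 ltc.
have c_gt0 : 0 < c by rewrite lt_def c_neq0.
pose e := v (x + y) / c - 1.
have e_gt0 : 0 < e by rewrite subr_gt0 ltr_pdivlMr // mul1r.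
(* Bernoulli: the powers of [1 + e] exceed 2 *)
have bern k : 1 + e *+ k <= (1 + e) ^+ k.
  elim: k => [|k IHk]; first by rewrite mulr0n addr0 expr0.
  rewrite exprS; apply: le_trans (_ : (1 + e) * (1 + e *+ k) <= _).
    rewrite mulrDr mulr1 mulrDl mul1r mulrS !addrA lerDl.
    by rewrite mulr_ge0 ?mulrn_wge0 // ltW.
  by rewrite ler_wpM2l // addr_ge0 ?ltW.
have le2 k : 1 + e *+ (p ^ k) <= 2.
  apply: le_trans (bern _) _; rewrite /e addrC subrK expr_div_n.
  by rewrite ler_pdivrMr ?exprn_gt0.
pose k := (Num.truncn (1 / e)).+1.
have := le2 k; apply/negP; rewrite -ltNge -[2]/(1 + 1) ltrD2l.
have : 1 / e < k%:R by apply: truncnS_gt.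
rewrite ltr_pdivrMr // => /lt_le_trans; apply.
rewrite mulr_natl; apply: ler_wpMn2l; first exact: ltW.
exact: ltnW (ltn_expl k p_gt1).
Qed.

Lemma absv_sum_lt p (pL : p \in [pchar L]) (I : finType) (P : pred I)
    (x : I -> L) c :
  0 < c -> (forall i, P i -> v (x i) < c) -> v (\sum_(i | P i) x i) < c.
Proof.
move=> c0 xc; elim/big_ind: _ => [|a b ac bc|//]; first by rewrite absv0.
apply: le_lt_trans (absv_ultra pL (c := Num.max (v a) (v b)) _ _) _.
- by rewrite le_max lexx.
- by rewrite le_max lexx orbT.
- by rewrite gt_max ac.
Qed.

(** If the nonzero terms of a sum have distinct absolute values, the largest
    one strictly dominates the sum of all the others, so that no cancellation
    can occur. *)
Lemma absv_term_le p (pL : p \in [pchar L]) (I : finType) (x : I -> L) :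
    (forall i j, x i != 0 -> v (x i) = v (x j) -> i = j) ->
  forall i, v (x i) <= v (\sum_i x i).
Proof.
move=> x_inj i; case: (@arg_maxP _ _ _ i xpredT (v \o x)) => //= j _ jmax.
apply: le_trans (jmax i isT) _.
have [xj0|xj0] := eqVneq (x j) 0; first by rewrite xj0 absv0 (absv_ge0 v_abs).
have vxj : 0 < v (x j).
  rewrite lt_def (absv_ge0 v_abs) andbT.
  by apply/eqP => /(absv_eq0 v_abs)/eqP; apply/negP.
have lt_rest : v (\sum_(k | k != j) x k) < v (x j).
  apply: (absv_sum_lt pL) => // k kj; rewrite lt_neqAle (jmax k isT) andbT.
  by apply: contraNneq kj => /esym/(x_inj _ _ xj0) ->.
rewrite (bigD1 j) //=; set rest := \sum_(k | _) _ in lt_rest *.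
rewrite leNgt; apply/negP => lt_sum.
have : v (x j) <= Num.max (v (x j + rest)) (v rest).
  rewrite -{1}[x j](addrK rest).
  by apply: (absv_ultra pL); rewrite ?absvN le_max lexx ?orbT.
by rewrite leNgt gt_max lt_sum lt_rest.
Qed.

End AbsoluteValue.

(** * Splitting a polynomial by residues of exponents *)

(** The polynomial [p_i] of the decomposition
    [p = \sum_(i < l) p_i('X^l) * 'X^i]. *)
Definition mod_part (F : nzRingType) (l i : nat) (p : {poly F}) : {poly F} :=
  \sum_(j < size p | (j %% l == i)%N) p`_j *: 'X^(j %/ l)%N.

Lemma horner_mod_part (F : fieldType) (L : comNzRingType)
    (phi : {rmorphism F -> L}) l (p : {poly F}) (x : L) : (0 < l)%N ->
  (map_poly phi p).[x] =
    \sum_(i < l) (map_poly phi (mod_part l i p)).[x ^+ l] * x ^+ i.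
Proof.
move=> l0; rewrite -[p in LHS]coefK poly_def raddf_sum horner_sum.
rewrite (partition_big (fun j : 'I__ => Ordinal (ltn_pmod j l0)) xpredT) //=.
apply: eq_bigr => i _; rewrite /mod_part raddf_sum horner_sum mulr_suml.
apply: eq_big => [//|j /eqP[ji]].
rewrite /= !map_polyZ !map_polyXn !hornerZ !hornerXn -mulrA -exprM -exprD.
by rewrite -ji /= mulnC -divn_eq.
Qed.

(** * The completion and its ramified extension *)

Lemma ldegE (F : fieldType) (a : laurent F) d : is_ldeg a d -> ldeg a = d.
Proof.
case=> ad0 ad; rewrite /ldeg; case: xgetP => [e _ [ae0 ae]|/(_ d) []//].
case: (ltgtP e d) => // [/ae/eqP|/ad/eqP]; first by rewrite (negPf ad0).
by rewrite (negPf ae0).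
Qed.

Lemma ldeg_laurT (F : fieldType) : ldeg (laurT : laurent F) = 1.
Proof.
apply: ldegE; split=> [|n n1] /=; first by rewrite oner_eq0.
by rewrite gt_eqF.
Qed.

Lemma laurT_neq0 (F : fieldType) : (laurT : laurent F) != 0.
Proof.
by apply/eqP => /laurentP/(_ 1); rewrite lzeroE /= => /eqP; rewrite oner_eq0.
Qed.

Section RootExtension.
Variables (F : finFieldType) (R : realType) (l : nat).
Variables (L : fieldExtType (laurent F)) (theta : L) (v : L -> R).
Hypothesis L_ext : root_extension l theta v.

Let v_abs := root_ext_absv L_ext.

Lemma absv_theta_pow : v theta ^+ l = #|F|%:R.
Proof.
rewrite -(absvX v_abs) (root_ext_pow L_ext) (root_ext_extends L_ext).
by rewrite /labs (negPf (laurT_neq0 F)) ldeg_laurT expr1z.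
Qed.

Lemma absv_theta_gt1 : 1 < v theta.
Proof.
rewrite ltNge; apply/negP => t1.
have := exprn_ile1 l (absv_ge0 v_abs theta) t1.
by rewrite absv_theta_pow leNgt ltr1n finNzRing_gt1.
Qed.

Lemma root_ext_pchar : exists p, p \in [pchar L].
Proof.
have [p _ pF] := finPcharP F; exists p.
exact: (rmorph_pchar (in_alg L \o @laurC F)).
Qed.

(** The value group of K is generated by [v theta ^ l], so that terms with
    exponents distinct modulo [l] cannot have the same absolute value; the
    factor [theta ^+ i] can then be dropped because [v theta > 1]. *)
Lemma absv_coef_le (a : 'I_l -> laurent F) i :
  v (a i)%:A <= v (\sum_(k < l) (a k)%:A * theta ^+ k).
Proof.
have [p pL] := root_ext_pchar.
have t1 := absv_theta_gt1; have t0 : 0 < v theta := lt_trans ltr01 t1.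
apply: le_trans (_ : v ((a i)%:A * theta ^+ i) <= _).
  rewrite (absvM v_abs) (absvX v_abs) ler_peMr ?(absv_ge0 v_abs) //.
  exact/exprn_ege1/ltW.
apply: (absv_term_le v_abs pL (x := fun k => (a k)%:A * theta ^+ k)) => {i} i j.
have termE k : a k != 0 ->
    v ((a k)%:A * theta ^+ k) = v theta ^ (l%:Z * ldeg (a k) + k%:Z).
  move=> ak; rewrite (absvM v_abs) (absvX v_abs) (root_ext_extends L_ext).
  rewrite /labs (negPf ak) -absv_theta_pow expfzDr ?gt_eqF //.
  by rewrite -exprz_exp -!exprnP.
move=> xi0; have ai : a i != 0.
  by apply: contraNneq xi0 => ->; rewrite scale0r mul0r.
have [aj|aj] := eqVneq (a j) 0.
  rewrite aj scale0r mul0r (absv0 v_abs) => /(absv_eq0 v_abs)/eqP.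
  by rewrite (negPf xi0).
have t_neq1 : v theta != 1 by rewrite gt_eqF.
rewrite !termE // => /(ieexprIz t0 t_neq1) eq_exp; apply: val_inj => /=.
move/(congr1 (modz^~ l%:Z)): eq_exp; rewrite !(mulrC l%:Z) !modzMDl !modz_nat.
by rewrite !modn_small // => -[].
Qed.

End RootExtension.

(** * The two lattices *)

Section Lattices.
Variables (F : finFieldType) (L : fieldExtType (laurent F)).

Lemma poly_values_pow (x : L) l y : poly_values (x ^+ l) y -> poly_values x y.
Proof.
case=> p _ <-; exists (p \Po 'X^l) => //.
by rewrite map_comp_poly map_polyXn horner_comp hornerXn.
Qed.

Lemma lattice_sub k (h : 'M[L]_k) (S1 S2 : set L) w :
  (forall y, S1 y -> S2 y) -> lattice h S1 w -> lattice h S2 w.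
Proof. by move=> S12 [z Sz <-]; exists z => // i; apply: S12. Qed.

(** A polynomial in [T] lies in K, which is where the unipotent matrix acts. *)
Lemma poly_value_in_alg (p : {poly F}) :
  (map_poly (in_alg L \o @laurC F) p).[laurT%:A] =
    ((map_poly (@laurC F) p).[laurT])%:A.
Proof. by rewrite map_poly_comp /= -[laurT%:A]/(in_alg L laurT) horner_map. Qed.

End Lattices.

Lemma mulmx_diagl (K : comNzRingType) k p (g : 'M[K]_k) (A : 'M[K]_(k, p)) i j :
  is_diag_mx g -> (g *m A) i j = g i i * A i j.
Proof.
move/is_diag_mxP => gd; rewrite mxE (bigD1 i) //= big1 ?addr0 // => k0 k0i.
by rewrite gd ?mul0r // eq_sym.
Qed.

Section Descent.
Variables (F : finFieldType) (R : realType) (l : nat).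
Variables (L : fieldExtType (laurent F)) (theta : L) (v : L -> R).
Hypotheses (l_gt0 : (0 < l)%N) (L_ext : root_extension l theta v).

Let v_abs := root_ext_absv L_ext.

Lemma supnorm_le k (w1 w2 : 'cV[L]_k) :
  (forall i, v (w1 i ord0) <= v (w2 i ord0)) -> supnorm v w1 <= supnorm v w2.
Proof. by move=> le_w; apply: le_bigmax2 => i _; apply: le_w. Qed.

(** The vector [w'] comes from a nonzero component of the decomposition of [w]
    along the powers of [theta].  The diagonal factor [g] only rescales each
    coordinate, so that the comparison of [w'] with [w] can be made coordinate
    by coordinate, before [g] is applied, where it is [absv_coef_le]. *)
Lemma lattice_descent k (g : 'M[L]_k) (u : 'M[laurent F]_k) (w : 'cV[L]_k) :
    is_diag_mx g -> g *m map_mx (in_alg L) u \in unitmx ->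
    lattice (g *m map_mx (in_alg L) u) (poly_values theta) w -> w != 0 ->
  exists w', [/\ lattice (g *m map_mx (in_alg L) u) (poly_values laurT%:A) w',
                 w' != 0 & supnorm v w' <= supnorm v w].
Proof.
set gu := g *m _ => g_diag gu_unit [z /= z_poly <-] w0.
have {}z_poly j : exists p : {poly F},
    (map_poly (in_alg L \o @laurC F) p).[theta] = z j ord0.
  by have [p _ pz] := z_poly j; exists p.
have [p pz] := choice z_poly.
pose c (i : 'I_l) : 'cV[laurent F]_k :=
  \col_j (map_poly (@laurC F) (mod_part l i (p j))).[laurT].
have zE : z = \sum_(i < l) theta ^+ i *: map_mx (in_alg L) (c i).
  apply/colP => j; rewrite summxE -pz (horner_mod_part _ _ _ l_gt0).
  apply: eq_bigr => i _; rewrite !mxE mulrC (root_ext_pow L_ext).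
  by rewrite poly_value_in_alg.
have [i ci0] : exists i, map_mx (in_alg L) (c i) != 0.
  apply: contrapT => /forallNP call; case/eqP: w0.
  rewrite zE big1 ?mulmx0 // => i _.
  by have /negP/negPn/eqP -> := call i; rewrite scaler0.
exists (gu *m map_mx (in_alg L) (c i)); split.
- exists (map_mx (in_alg L) (c i)) => // j; rewrite !mxE.
  by exists (mod_part l i (p j)) => //; rewrite poly_value_in_alg.
- apply: contraNneq ci0 => /(congr1 (mulmx (invmx gu))).
  by rewrite mulKmx // mulmx0 => ->.
apply: supnorm_le => j.
have guE i' : (gu *m map_mx (in_alg L) (c i')) j ord0 =
    g j j * ((u *m c i') j ord0)%:A.
  by rewrite -mulmxA mulmx_diagl // -map_mxM mxE.
have -> : (gu *m z) j ord0 =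
    g j j * \sum_(i' < l) ((u *m c i') j ord0)%:A * theta ^+ i'.
  rewrite zE mulmx_sumr summxE mulr_sumr; apply: eq_bigr => i' _.
  by rewrite -scalemxAr mxE guE mulrC -mulrA.
rewrite guE !(absvM v_abs) ler_wpM2l ?(absv_ge0 v_abs) //.
exact: (absv_coef_le L_ext (fun i' => (u *m c i') j ord0)).
Qed.

End Descent.

Theorem proposition6p1 (F : finFieldType) (R : realType) (l m n : nat)
    (l_gt0 : (0 < l)%N) (m_gt0 : (0 < m)%N) (n_gt0 : (0 < n)%N)
    (L : fieldExtType (laurent F)) (theta : L) (v : L -> R)
    (L_ext : root_extension l theta v)
    (g : 'M[L]_(m + n)) (g_diag : is_diag_mx g) (g_SL : \det g = 1)
    (alpha : 'M[laurent F]_(m, n)) :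
  let gu := g *m map_mx (in_alg L) (unip alpha) in
  lambda1 v (lattice gu (poly_values theta)) =
  lambda1 v (lattice gu (poly_values laurT%:A)).
Proof.
move=> gu; have gu_unit : gu \in unitmx.
  rewrite unitmxE det_mulmx g_SL mul1r det_map_mx det_ublock !det1 mulr1.
  by rewrite rmorph1 unitr1.
rewrite /lambda1; congr (inf _); apply/seteqP; split=> r /= [r0 [w [Gw w0 wr]]].
  have [w' [Gw' w'0 w'w]] := lattice_descent l_gt0 L_ext g_diag gu_unit Gw w0.
  by split=> //; exists w'; split=> //; apply: le_trans wr.
split=> //; exists w; split=> //; apply: lattice_sub Gw => y.
by rewrite -(root_ext_pow L_ext); apply: poly_values_pow.
Qed.
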